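(* Let $n\ge 1$. The number of isomorphism classes of representations among $\tau_{n,1},\dots,\tau_{n,n}$ is $|D_n|$.
   Context: Define $D_n=\{k \text{ a positive divisor of } n:\ n/k\equiv n \pmod 2\}$. $S_n$ is the group of permutations of $[n]=\{1,\dots,n\}$; $\pi_i$ denotes the image of $i$ under $\pi$. $\mathbb{Z}_n$ is the set of integers modulo $n$, with representatives in $\{0,\dots,n-1\}$. An integer sequence $(x_1,\dots,x_m)$ is a parking function of length $m$ if its weakly increasing rearrangement $(z_1,\dots,z_m)$ satisfies $0\le z_i\le i-1$ for $i=1,\dots,m$. $\mathrm{PF}_m$ is the set of parking functions of length $m$ ($\mathrm{PF}_0$ consists of the empty sequence). Entries of elements of $\mathrm{PF}_{n-1}$ lie in $\{0,\dots,n-1\}$ and are viewed as elements of $\mathbb{Z}_n$. For $1\le c\le n$ let $$\widehat{\mathrm{PF}}_{n,c}=\Big\{(x_1,\dots,x_n)\in\mathbb{Z}_n^n:\ (x_1,\dots,x_{n-1})\in\mathrm{PF}_{n-1},\ x_n\equiv c-\sum_{i=1}^{n-1}x_i \pmod n\Big\}.$$ Definition of the $S_n$-action $\tau_{n,c}$ on $\widehat{\mathrm{PF}}_{n,c}$: for $\pi\in S_n$ and $(x_1,\dots,x_n)\in\widehat{\mathrm{PF}}_{n,c}$, by a theorem of Pollak there is exactly one $y\in\mathbb{Z}_n$ such that $(y+x_{\pi_1},\dots,y+x_{\pi_{n-1}})$ (addition modulo $n$) is in $\mathrm{PF}_{n-1}$; for this $y$ one has $(y+x_{\pi_1},\dots,y+x_{\pi_n})\in\widehat{\mathrm{PF}}_{n,c}$,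 and one sets $\pi\cdot(x_1,\dots,x_n)=(y+x_{\pi_1},\dots,y+x_{\pi_n})$. Products of permutations are read left to right (first $\pi$, then $\sigma$, in $\pi\sigma$), so that this is a left action. $\tau_{n,c}$ also denotes the associated complex permutation representation of $S_n$, and isomorphism means isomorphism of complex representations. *)

(* Defs.v *)
(* The complex numbers are R[i] for R : realType.

   Throughout, n is written m.+1: both [n] and Z_n are 'I_m.+1 (the former
   0-based, the latter with the additive group structure of zmodp), and the
   first n - 1 positions of [n] are the widen_ord images of 'I_m. *)
From HB Require Import structures.
From mathcomp Require Import all_boot all_order all_algebra all_fingroup.
From mathcomp Require Import mxrepresentation zify.
From mathcomp Require Import boolp reals complex.

Set Implicit Arguments.
Unset Strict Implicit.
Unset Printing Implicit Defensive.

Import GRing.Theory.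
Local Open Scope ring_scope.

Definition D (n : nat) : seq nat :=
  [seq k <- divisors n | (n %/ k == n %[mod 2])%N].

(* The condition is 0-based, and 0 <= z_i is implicit in the type nat. *)
Definition parking (s : seq nat) : bool :=
  [forall i : 'I_(size s), (nth 0 (sort leq s) i <= i)%N].

Lemma parkingP (s : seq nat) :
  reflect (forall k, k <= size s -> k <= count (fun v => v < k) s)%N
          (parking s).
Proof.
have szt : size (sort leq s) = size s by rewrite size_sort.
have st : sorted leq (sort leq s) by apply: sort_sorted; exact: leq_total.
have ct k : count (fun v => v < k)%N s = count (fun v => v < k)%N (sort leq s).
  by apply/seq.permP; rewrite perm_sym perm_sort.
have nth_le i j : (i <= j -> j < size s ->
    nth 0 (sort leq s) i <= nth 0 (sort leq s) j)%N.
  move=> ij js; apply: (sorted_leq_nth leq_trans leqnn 0%N st) => //;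
    by rewrite inE szt // (leq_ltn_trans ij js).
apply: (iffP forallP) => [h k ks | h i].
  rewrite ct -[sort leq s](cat_take_drop k) count_cat.
  apply: leq_trans (leq_addr _ _).
  have stk : size (take k (sort leq s)) = k by rewrite size_takel // szt.
  rewrite -[X in (X <= _)%N]stk.
  suff : all (fun v => v < k)%N (take k (sort leq s)).
    by rewrite all_count => /eqP ->.
  apply/(all_nthP 0%N) => i; rewrite stk => ik; rewrite nth_take //.
  have is_ : (i < size s)%N by exact: leq_trans ik ks.
  exact: leq_ltn_trans (h (Ordinal is_)) ik.
rewrite leqNgt; apply/negP => hi.
have := h i.+1 (ltn_ord i); rewrite ct -[sort leq s](cat_take_drop i) count_cat.
have -> : count (fun v => v < i.+1)%N (drop i (sort leq s)) = 0%N.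
  apply/eqP; rewrite -leqn0 leqNgt -has_count; apply/hasPn => v.
  case/(nthP 0%N) => j; rewrite size_drop szt nth_drop => hj <-.
  rewrite -leqNgt; apply: leq_trans hi _; apply: nth_le; lia.
have := count_size (fun v => v < i.+1)%N (take i (sort leq s)).
rewrite size_takel ?szt; [lia | exact: ltnW].
Qed.

Section ParkingZn.
Variable m : nat.
Implicit Types (x : {ffun 'I_m.+1 -> 'I_m.+1}) (y : 'I_m.+1).

Definition init x : seq nat :=
  [seq nat_of_ord (x (widen_ord (leqnSn m) i)) | i <- enum 'I_m].

Definition shift y x : {ffun 'I_m.+1 -> 'I_m.+1} := [ffun i => y + x i].

Definition in_PF x : bool := parking (init x).

End ParkingZn.

Section Pollak.
Variable m : nat.
Implicit Types (x : {ffun 'I_m.+1 -> 'I_m.+1}) (y : 'I_m.+1).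

Let C x (j : nat) : nat :=
  count (fun i : 'I_m => x (widen_ord (leqnSn m) i) == inZp j) (enum 'I_m).
Let P x (a : nat) : nat := (\sum_(0 <= j < a) C x j)%N.

Let count_shift x (t : 'I_m.+1) k : (k <= m.+1)%N ->
  count (fun v => v < k)%N (init (shift (- t) x)) = (P x (t + k) - P x t)%N.
Proof.
move=> km; rewrite /P (@big_cat_nat _ _ _ t) ?leq_addr //= addKn.
have -> : (\sum_(t <= j < t + k) C x j = \sum_(0 <= j < k) C x (j + t))%N.
  by have := big_addn 0 (t + k) t predT (C x); rewrite add0n addKn; apply.
have inZpD j : inZp (j + t) = inZp j + t :> 'I_m.+1.
  by apply: val_inj; rewrite /= modnDml.
elim: k km => [|k IH] km; first by rewrite big_geq // (@eq_count _ _ pred0) ?count_pred0.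
rewrite big_nat_recr //= -IH ?(ltnW km) // /C !count_map -count_predUI.
rewrite [X in (_ + X)%N](@eq_count _ _ pred0) ?count_pred0 ?addn0; last first.
  move=> i /=; apply/negP => /andP[+ /eqP xi].
  by rewrite ffunE xi inZpD addrC addrK /= modn_small // ltnn.
apply: eq_count => i /=; rewrite !ffunE ltnS leq_eqVlt orbC; congr (_ || _).
by rewrite inZpD -subr_eq addrC -[RHS]val_eqE /= (modn_small km).
Qed.

Let PS x (t : nat) : P x (t + m.+1) = (P x t + m)%N.
Proof.
have CS j : C x (j + m.+1) = C x j.
  rewrite /C; apply: eq_count => i; congr (_ == _).
  by apply: val_inj; rewrite /= modnDr.
elim: t => [|t IH]; last first.
  by rewrite addSn /P !big_nat_recr //= -!/(P x _) IH CS; lia.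
have := @count_shift x ord0 _ (leqnn m.+1).
rewrite /= [P x 0]big_geq // subn0 => <-.
rewrite add0n (@eq_in_count _ _ predT) ?count_predT.
  by rewrite size_map size_enum_ord.
by move=> v /mapP [i _ ->]; rewrite ltn_ord.
Qed.

Let in_PF_shiftP x (t : 'I_m.+1) :
  reflect (forall k, k <= m -> P x t + k <= P x (t + k))%N
          (in_PF (shift (- t) x)).
Proof.
have le a k : (P x a <= P x (a + k))%N.
  by rewrite /P (@big_cat_nat _ _ _ a _ (a + k)) ?leq_addr.
have sz : size (init (shift (- t) x)) = m by rewrite size_map size_enum_ord.
apply: (iffP (parkingP _)); rewrite sz => h k km; have := h k km; have := le t k;
  rewrite count_shift ?leqW //; lia.
Qed.

Theorem pollak x : exists! y, in_PF (shift y x).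
Proof.
pose w (t : 'I_m.+1) := ((P x t + (m - t)) * m.+1 + t)%N.
pose t := [arg min_(t < ord0) w t].
have tmin j : (w t <= w j)%N by rewrite /t; case: arg_minnP => // i _; apply.
have good : in_PF (shift (- t) x).
  apply/in_PF_shiftP => k km; have := ltn_ord t.
  case: (ltnP (t + k) m.+1) => tk tm.
    have := tmin (Ordinal tk); rewrite /w /=; nia.
  have jm : (t + k - m.+1 < m.+1)%N by lia.
  have := tmin (Ordinal jm); rewrite /w /=.
  have -> : P x (t + k) = (P x (t + k - m.+1) + m)%N by rewrite -PS subnK.
  set p := P x _; set q := P x _.
  have : (t + k - m.+1 < t)%N by lia.
  nia.
exists (- t); split=> // y.
rewrite -[y]opprK; move: (- y) => u gu; congr (- _).
wlog tu : t u good gu {tmin} / (t <= u)%N.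
  by move=> W; case: (leqP t u) => [|/ltnW] tu; [exact: W | apply/esym/W].
apply: val_inj => /=; apply/eqP; rewrite eqn_leq tu leqNgt; apply/negP => lt.
have um := ltn_ord u.
have k1 : (u - t <= m)%N by lia.
have k2 : (m.+1 - (u - t) <= m)%N by lia.
have := in_PF_shiftP _ _ good _ k1; have := in_PF_shiftP _ _ gu _ k2.
rewrite subnKC //.
have -> : (u + (m.+1 - (u - t)) = t + m.+1)%N by lia.
rewrite PS; lia.
Qed.

End Pollak.

Section Action.
Variable m : nat.
Implicit Types (x : {ffun 'I_m.+1 -> 'I_m.+1}) (y : 'I_m.+1) (c : nat).

Lemma pollak_ex x : exists y, in_PF (shift y x).
Proof. by have [y [hy _]] := pollak x; exists y. Qed.

Definition pf_shift x : 'I_m.+1 := xchoose (pollak_ex x).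

Lemma pf_shiftP x : in_PF (shift (pf_shift x) x).
Proof. exact: (xchooseP (pollak_ex x)). Qed.

Lemma pf_shift_uniq x y : in_PF (shift y x) -> pf_shift x = y.
Proof.
by have [z [_ hz]] := pollak x => hy; rewrite -(hz _ (pf_shiftP x)) -(hz _ hy).
Qed.

(* inZp is reduction modulo n. *)
Definition PF_hat (c : nat) : {set {ffun 'I_m.+1 -> 'I_m.+1}} :=
  [set x : {ffun 'I_m.+1 -> 'I_m.+1} | in_PF x &
    x ord_max == inZp c - \sum_(i < m) x (widen_ord (leqnSn m) i)].

Definition permute (p : 'S_m.+1) x : {ffun 'I_m.+1 -> 'I_m.+1} :=
  [ffun i => x (p i)].

Definition tau_act (p : 'S_m.+1) x : {ffun 'I_m.+1 -> 'I_m.+1} :=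
  shift (pf_shift (permute p x)) (permute p x).

Lemma PF_hatE c x :
  (x \in PF_hat c) = in_PF x && (\sum_i x i == inZp c).
Proof. by rewrite inE big_ord_recr /= eq_sym subr_eq addrC eq_sym. Qed.

Lemma tau_act_PF_hat c p x : x \in PF_hat c -> tau_act p x \in PF_hat c.
Proof.
rewrite !PF_hatE pf_shiftP /= => /andP[_ /eqP <-].
under eq_bigr do rewrite !ffunE.
rewrite big_split /= sumr_const card_ord.
have -> (y : 'I_m.+1) : y *+ m.+1 = 0.
  by apply: val_inj; rewrite Zp_mulrn /= modnMl.
by rewrite add0r [X in _ == X](reindex_inj (@perm_inj _ p)).
Qed.

Lemma tau_act1 c x : x \in PF_hat c -> tau_act 1%g x = x.
Proof.
rewrite PF_hatE => /andP[hx _].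
have -> : tau_act 1%g x = shift (pf_shift x) x.
  have e : permute 1%g x = x by apply/ffunP => i; rewrite ffunE perm1.
  by rewrite /tau_act e.
have e : shift 0 x = x by apply/ffunP => i; rewrite ffunE add0r.
by rewrite (@pf_shift_uniq x 0) ?e.
Qed.

Lemma tau_actM p q x : tau_act (p * q)%g x = tau_act p (tau_act q x).
Proof.
set z := permute p (tau_act q x).
have e (u : 'I_m.+1) : shift u z =
    shift (u + pf_shift (permute q x)) (permute (p * q)%g x).
  by apply/ffunP => i; rewrite !ffunE permM addrA.
rewrite {2}/tau_act -/z e /tau_act.
by congr shift; apply: pf_shift_uniq; rewrite -e pf_shiftP.
Qed.

(* Column j of tau_mx p is the basis vector of the image under p of the j-th
   element of PF_hat c, so that a left action yields a homomorphism. *)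
Definition tau_mx (F : fieldType) (c : nat) (p : 'S_m.+1) :
    'M[F]_#|PF_hat c| :=
  \matrix_(i, j) (enum_val i == tau_act p (enum_val j))%:R.

Lemma tau_mx_repr F c : mx_repr [set: 'S_m.+1] (@tau_mx F c).
Proof.
split=> [|p q _ _]; apply/matrixP => i j; rewrite !mxE.
  by rewrite (tau_act1 (enum_valP j)) (inj_eq enum_val_inj).
have hq := tau_act_PF_hat q (enum_valP j).
rewrite (bigD1 (enum_rank_in hq (tau_act q (enum_val j)))) //= !mxE.
rewrite enum_rankK_in // eqxx mulr1 tau_actM big1 ?addr0 // => k.
rewrite !mxE => kN; case: (eqVneq (enum_val k)) => [e|_]; last by rewrite mulr0.
by case/eqP: kN; apply: enum_val_inj; rewrite enum_rankK_in.
Qed.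

End Action.

Definition tau (R : realType) (m c : nat) :
    mx_representation R[i] [set: 'S_m.+1] #|PF_hat m c| :=
  MxRepresentation (@tau_mx_repr m R[i] c).

Arguments tau : clear implicits.

Definition tau_iso (R : realType) (m c d : nat) : bool :=
  `[< mx_rsim (tau R m c) (tau R m d) >].

Lemma tau_iso_equivalence (R : realType) (m : nat) :
  equivalence_rel (tau_iso R m).
Proof.
move=> a b c; split; first exact/asboolP/mx_rsim_refl.
move=> /asboolP ab; apply/asboolP/asboolP; last exact: mx_rsim_trans.
exact: mx_rsim_trans (mx_rsim_sym ab).
Qed.

(* The index i : 'I_m.+1 stands for tau_{n,i+1}, i.e. c runs from 1 to n. *)
Definition tau_classes (R : realType) (m : nat) : {set {set 'I_m.+1}} :=
  equivalence_partition (fun i j : 'I_m.+1 => tau_iso R m i.+1 j.+1)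
    [set: 'I_m.+1].

(* Main.v *)
(* Up to constant shifts, PF_hat c is the set of x in Z_n^n with sum c. With
   N = n for n odd and N = n/2 for n even, D n is the set of divisors of N, and
   tau_c and tau_d are isomorphic iff gcd(c, N) = gcd(d, N).

   Isomorphisms: if u is a unit modulo n and d = u c, then x |-> u x is an
   isomorphism of S_n-sets. If n is even and c - d = n/2, the kernel
   theta^(sum_i (x_i - y_i)^2), with theta a primitive 2n-th root of unity, is
   invariant under shifts of x and of y and under S_n; it is invertible, since
   its product with the conjugate transpose is a sum of characters, hence a
   nonzero scalar.

   Non-isomorphism: if k divides N, the rotation i |-> i + n/k of Z_n has a
   fixed point in PF_hat c iff k divides c, so traces separate the classes. *)
Require Import Defs.
From mathcomp Require Import all_boot all_algebra all_fingroup.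
From mathcomp Require Import cyclic separable cyclotomic mxrepresentation zify.
From mathcomp Require Import boolp reals complex.

Set Implicit Arguments.
Unset Strict Implicit.
Unset Printing Implicit Defensive.

Import GRing.Theory Num.Theory.
Local Open Scope ring_scope.

(** * Arithmetic *)

Lemma dvdn_modr (d a n : nat) : (d %| n)%N -> (d %| a %% n)%N = (d %| a)%N.
Proof. by move=> dn; rewrite {2}(divn_eq a n) dvdn_addr // dvdn_mull. Qed.

Lemma coprime_inv_mod (u n : nat) :
  coprime u n -> exists w, (u * w = 1 %[mod n])%N.
Proof.
case: u => [|u co].
  by rewrite /coprime gcd0n => /eqP ->; exists 0%N; rewrite !modn1.
have [[w v] /= e] := coprimeP n (ltn0Sn u) co.
exists w; rewrite mulnC -(subnK (n := w * u.+1) (m := v * n)); last lia.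
by rewrite e addnC modnMDl.
Qed.

(** With g the common gcd, c/g and d/g are units modulo n/g, hence so is their quotient; it remains
    to lift a unit modulo n/g to a unit modulo n. *)
Lemma gcdn_unit_lift (c d n : nat) : (0 < n)%N -> gcdn c n = gcdn d n ->
  exists2 u, coprime u n & (c * u = d %[mod n])%N.
Proof.
move=> n0 cd; have g0 : (0 < gcdn c n)%N by rewrite gcdn_gt0 n0 orbT.
set g := gcdn c n in cd g0.
have [c1 ec] : exists c1, c = (c1 * g)%N by apply/dvdnP/dvdn_gcdl.
have [n1 en] : exists n1, n = (n1 * g)%N by apply/dvdnP/dvdn_gcdr.
have [d1 ed] : exists d1, d = (d1 * g)%N by apply/dvdnP; rewrite cd dvdn_gcdl.
have co x : gcdn (x * g) n = g -> coprime x n1.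
  by rewrite en -muln_gcdl => /eqP; rewrite -{2}[g]mul1n eqn_pmul2r.
have cc : coprime c1 n1 by apply: co; rewrite -ec.
have cd1 : coprime d1 n1 by apply: co; rewrite -ed.
have [w c1w] := coprime_inv_mod cc.
have cw : coprime w n1.
  have : coprime (c1 * w) n1.
    by rewrite -coprime_modl c1w coprime_modl coprime1n.
  by rewrite coprimeMl => /andP[].
(* u0 is a unit modulo n1; adding k n1 makes it coprime to n, as each prime
   factor of n divides exactly one of u0 and k n1. The summand n1 keeps u0
   positive. *)
pose u0 := (w * d1 + n1)%N; pose k := (n`_(\pi(u0)^'))%N.
have n10 : (0 < n1)%N by case: (n1) en n0 => // ->.
have u00 : (0 < u0)%N by rewrite /u0; lia.
have cu0 : coprime u0 n1.
  rewrite coprime_sym /coprime gcdnDr -/(coprime _ _) coprimeMr.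
  by rewrite !(coprime_sym n1) cw.
exists (u0 + k * n1)%N; last first.
  rewrite ec ed en mulnAC -!muln_modl; congr (_ * _)%N.
  rewrite mulnDr mulnA addnC modnMDl /u0 mulnDr addnC modnMDl mulnA.
  by rewrite -modnMml c1w modnMml mul1n.
rewrite coprime_has_primes //; last by lia.
apply/hasPn => p; rewrite !mem_primes => /and3P[pr _ pn].
apply/negP => /and3P[_ _ pu]; have pu0 : (p %| u0)%N.
  apply/negPn/negP => npu0; have pk : (p %| k)%N.
    rewrite -[p](@part_pnat_id (\pi(u0)^')) ?partn_dvd // pnatE // inE /=.
    by rewrite mem_primes pr u00.
  by move: pu; rewrite dvdn_addl ?dvdn_mulr // (negPf npu0).
move: pu; rewrite dvdn_addr // Euclid_dvdM // => /orP[pk|pn1].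
  have /(pnat_dvd pk) : (\pi(u0)^').-nat k by exact: part_pnat.
  by rewrite pnatE // inE /= mem_primes pr u00 pu0.
have : (p %| gcdn u0 n1)%N by rewrite dvdn_gcd pu0.
by rewrite (eqP cu0) dvdn1 => /eqP p1; rewrite p1 in pr.
Qed.

(** Let g be the common gcd. As c/g is prime to h/g, the gcd of c with 2h is g or 2g according to
    the parity of c/g. If h/g is even, c/g and d/g are both odd; otherwise adding h to c flips that
    parity. *)
Lemma gcdn_half (c d h : nat) : (0 < h)%N -> gcdn c h = gcdn d h ->
  gcdn c h.*2 = gcdn d h.*2 \/ gcdn (c + h) h.*2 = gcdn d h.*2.
Proof.
move=> h0 cd; have g0 : (0 < gcdn c h)%N by rewrite gcdn_gt0 h0 orbT.
set g := gcdn c h in cd g0.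
have [c1 ec] : exists c1, c = (c1 * g)%N by apply/dvdnP/dvdn_gcdl.
have [h1 eh] : exists h1, h = (h1 * g)%N by apply/dvdnP/dvdn_gcdr.
have [d1 ed] : exists d1, d = (d1 * g)%N by apply/dvdnP; rewrite cd dvdn_gcdl.
have co x : gcdn (x * g) h = g -> coprime x h1.
  by rewrite eh -muln_gcdl => /eqP; rewrite -{2}[g]mul1n eqn_pmul2r.
have cc : coprime c1 h1 by apply: co; rewrite -ec.
have cd1 : coprime d1 h1 by apply: co; rewrite -ed.
have gE x : coprime x h1 -> gcdn (x * g) h.*2 = (gcdn 2 (odd x) * g)%N.
  move=> cx; rewrite eh -mul2n mulnA -muln_gcdl Gauss_gcdl // gcdnC.
  by rewrite -modn2 gcdn_modr.
have -> : (c + h = (c1 + h1) * g)%N by rewrite mulnDl -ec -eh.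
rewrite {1}ec ed !gE //; last first.
  by rewrite coprime_sym /coprime gcdnDr -/(coprime _ _) coprime_sym.
have [->|ne] := eqVneq (odd c1) (odd d1); [by left|right].
have -> : odd (c1 + h1) = odd d1; last by [].
rewrite oddD; case oh: (odd h1); first by case: (odd c1) (odd d1) ne => [] [].
suff oc x : coprime x h1 -> odd x by rewrite !oc in ne.
by move=> cx; rewrite -coprimen2; apply: coprime_dvdr cx; rewrite dvdn2 oh.
Qed.

Definition half_if_even (n : nat) : nat := if odd n then n else n./2.

(** Divisors of an odd n always have odd cofactor; for even n, an even cofactor n/k means that k
    divides n/2. *)
Lemma half_if_even_dvd (n k : nat) : (0 < n)%N ->
  (k %| half_if_even n)%N =
  (k %| n)%N && (n %/ k == n %[mod 2])%N.
Proof.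
move=> n0; rewrite /half_if_even; case: ifPn => on.
  case: (boolP (k %| n)%N) => //= /dvdnP[q e]; move: on n0.
  rewrite e muln_gt0 oddM => /andP[oq ok] /andP[q0 k0].
  by rewrite mulnK // !modn2 oddM oq ok.
have e2 : n = (n./2 * 2)%N by rewrite muln2 -[LHS]odd_double_half (negPf on).
apply/idP/andP => [kh | [/dvdnP[q e]]].
  have kn : (k %| n)%N by rewrite e2 dvdn_mulr.
  split=> //; rewrite !modn2 (negPf on) eqb0.
  case/dvdnP: kh => q e; have k0 : (0 < k)%N by case: k e {kn} => //; lia.
  by rewrite e2 e mulnAC mulnK // oddM andbF.
have k0 : (0 < k)%N by case: k e => //; lia.
rewrite e mulnK // -e !modn2 (negPf on) eqb0 => oq.
by rewrite e -[q]odd_double_half (negPf oq) add0n -doubleMl doubleK dvdn_mull.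
Qed.

Lemma half_if_even_gt0 (n : nat) : (0 < n)%N -> (0 < half_if_even n)%N.
Proof. by rewrite /half_if_even; case: ifPn => // on; lia. Qed.

Lemma size_D (n : nat) : (0 < n)%N ->
  size (D n) = size (divisors (half_if_even n)).
Proof.
move=> n0; apply/perm_size/uniq_perm; rewrite ?filter_uniq ?divisors_uniq //.
move=> k; rewrite mem_filter -!dvdn_divisors ?half_if_even_gt0 //.
by rewrite half_if_even_dvd // andbC.
Qed.

(** X^n - 1 splits and, n being nonzero in F, is separable; among its n distinct roots one is
    primitive. *)
Lemma prim_root_exists (F : closedFieldType) n :
  (n > 0)%N -> n%:R != 0 :> F -> exists z : F, n.-primitive_root z.
Proof.
pose p : {poly F} := 'X^n - 1; have [r Dp] := closed_field_poly_normal p.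
move=> n0 nF; rewrite (monicP _) ?monicXnsubC // scale1r in Dp.
have rn1 : all n.-unity_root r.
  by apply/allP => z; rewrite -root_prod_XsubC -Dp.
have szr : (n < (size r).+1)%N.
  by rewrite -(size_prod_XsubC r id) -Dp size_XnsubC.
have [|z _ hz] := hasP (has_prim_root n0 rn1 _ szr); last by exists z.
by rewrite -separable_prod_XsubC -Dp separable_Xn_sub_1.
Qed.

(** * Normalized words *)

Section Normalization.
Variable m : nat.
Notation Zn := 'I_m.+1.
Notation word := {ffun Zn -> Zn}.
Implicit Types (x y v : word) (a b t : Zn).

(** The canonical representative of [x] modulo constant words, unique by [pollak]. *)
Definition pf_norm x : word := shift (pf_shift x) x.

Lemma in_PF_norm x : in_PF (pf_norm x).
Proof. exact: pf_shiftP. Qed.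

Lemma shift0 x : shift 0 x = x.
Proof. by apply/ffunP => i; rewrite ffunE add0r. Qed.

Lemma shiftD t a x : shift t (shift a x) = shift (t + a) x.
Proof. by apply/ffunP => i; rewrite !ffunE addrA. Qed.

Lemma pf_norm_id x : in_PF x -> pf_norm x = x.
Proof.
by move=> hx; rewrite /pf_norm (@pf_shift_uniq _ x 0) ?shift0.
Qed.

Lemma pf_norm_shift t x : pf_norm (shift t x) = pf_norm x.
Proof.
have h := in_PF_norm (shift t x).
rewrite /pf_norm shiftD in h *.
by rewrite (pf_shift_uniq h).
Qed.

Lemma mulrn_ord t : t *+ m.+1 = 0.
Proof. by apply: val_inj; rewrite Zp_mulrn /= modnMl. Qed.

Lemma inZpD (a b : nat) : inZp (a + b)%N = inZp a + inZp b :> Zn.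
Proof. by apply: val_inj; rewrite /= modnDml modnDmr. Qed.

Lemma inZpM (a b : nat) : inZp (a * b) = inZp a *+ b :> Zn.
Proof. by apply: val_inj; rewrite Zp_mulrn /= modnMml. Qed.

Lemma inZp_val t : inZp t = t.
Proof. by apply: val_inj; rewrite /= modn_small. Qed.

Lemma sum_shift t x : \sum_i shift t x i = \sum_i x i.
Proof.
under eq_bigr do rewrite ffunE.
by rewrite big_split /= sumr_const card_ord mulrn_ord add0r.
Qed.

Lemma pf_norm_PF_hat c x :
  \sum_i x i = inZp c -> pf_norm x \in PF_hat m c.
Proof. by move=> e; rewrite PF_hatE in_PF_norm sum_shift e eqxx. Qed.

Lemma PF_hatP c x : x \in PF_hat m c -> in_PF x /\ \sum_i x i = inZp c.
Proof. by rewrite PF_hatE => /andP[? /eqP]. Qed.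

Lemma tau_actE p x : tau_act p x = pf_norm (permute p x).
Proof. by []. Qed.

Lemma permute_shift p t x : permute p (shift t x) = shift t (permute p x).
Proof. by apply/ffunP => i; rewrite !ffunE. Qed.

Lemma tau_act_norm p x : tau_act p (pf_norm x) = pf_norm (permute p x).
Proof. by rewrite tau_actE permute_shift pf_norm_shift. Qed.

Lemma tau_act_inj p x y : in_PF x -> in_PF y ->
  tau_act p x = tau_act p y -> x = y.
Proof.
move=> hx hy e; have := congr1 (tau_act p^-1%g) e.
have act1 (z : word) : in_PF z -> tau_act 1%g z = z.
  move=> hz; rewrite -[RHS](pf_norm_id hz) tau_actE; congr pf_norm.
  by apply/ffunP => i; rewrite ffunE perm1.
by rewrite -!tau_actM mulVg !act1.
Qed.

(** Addition of [v] on words modulo constants; it links the sets [PF_hat m c] for different c and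
    serves to reindex sums over one of them. *)
Definition translate v x : word := pf_norm (x + v).

Lemma translateK v x : in_PF x -> translate (- v) (translate v x) = x.
Proof.
move=> hx; rewrite /translate.
have -> : pf_norm (x + v) - v = shift (pf_shift (x + v)) x.
  by apply/ffunP => i; rewrite !ffunE; rewrite -addrA addrK.
by rewrite pf_norm_shift pf_norm_id.
Qed.

Lemma translate_PF_hat c d v x : \sum_i v i + inZp c = inZp d ->
  x \in PF_hat m c -> translate v x \in PF_hat m d.
Proof.
move=> e /PF_hatP[_ sx]; apply: pf_norm_PF_hat; rewrite -e -sx.
by under eq_bigr do rewrite ffunE; rewrite big_split /= addrC.
Qed.

Lemma card_PF_hat_le c d : (#|PF_hat m c| <= #|PF_hat m d|)%N.
Proof.
pose v : word := [ffun i => if i == ord0 then inZp d - inZp c else 0].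
have sv : \sum_i v i + inZp c = inZp d.
  rewrite (bigD1 ord0) //= big1 ?ffunE ?eqxx ?addr0 ?subrK // => i i0.
  by rewrite ffunE (negPf i0).
rewrite -(card_in_imset (f := translate v)).
  apply/subset_leq_card/subsetP => _ /imsetP[x hx ->].
  exact: translate_PF_hat sv hx.
move=> x y /PF_hatP[hx _] /PF_hatP[hy _] e.
by rewrite -(translateK v hx) -(translateK v hy) e.
Qed.

Lemma card_PF_hat c d : #|PF_hat m c| = #|PF_hat m d|.
Proof. by apply/eqP; rewrite eqn_leq !card_PF_hat_le. Qed.

Lemma PF_hat_gt0 c : (0 < #|PF_hat m c|)%N.
Proof.
rewrite (card_PF_hat c 0); apply/card_gt0P; exists (pf_norm 0).
apply: pf_norm_PF_hat; rewrite big1 => [|i _]; last by rewrite ffunE.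
by apply: val_inj; rewrite /= mod0n.
Qed.

(** * Intertwining kernels, traces and unit multiples *)

Notation tau_repr F c := (MxRepresentation (@tau_mx_repr m F c)).

(** Invariance makes the matrix of [K] an intertwiner. A one-sided inverse up to [s] suffices, since
    both sets have the same size. *)
Lemma tau_rsim_kernel (F : fieldType) c d (K K' : word -> word -> F) (s : F) :
  s != 0 ->
  (forall p x y, x \in PF_hat m c -> y \in PF_hat m d ->
     K (tau_act p x) (tau_act p y) = K x y) ->
  {in PF_hat m c &, forall x x',
     \sum_(y in PF_hat m d) K x y * K' y x' = s * (x == x')%:R} ->
  mx_rsim (tau_repr F c) (tau_repr F d).
Proof.
move=> s0 Kinv KK'.
pose B : 'M[F]_(#|PF_hat m c|, #|PF_hat m d|) :=
  \matrix_(i, j) K (enum_val i) (enum_val j).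
pose B' : 'M[F]_(#|PF_hat m d|, #|PF_hat m c|) :=
  \matrix_(i, j) K' (enum_val i) (enum_val j).
apply: (MxReprSim (B := B)); first exact: card_PF_hat.
  apply/row_freeP; exists (s^-1 *: B'); rewrite -scalemxAr.
  apply/matrixP => i j; rewrite !mxE.
  under eq_bigr do rewrite !mxE.
  rewrite -(big_enum_val (fun y => K (enum_val i) y * K' y (enum_val j))).
  by rewrite KK' ?enum_valP // mulKf // (inj_eq enum_val_inj).
move=> p _ /=; apply/matrixP => i j; rewrite !mxE.
under eq_bigr do rewrite !mxE.
under [RHS]eq_bigr do rewrite !mxE.
(* One index survives in each product, leaving [K] at (p^-1 x, y) on the left and at (x, p y) on the
   right; invariance under p equates them. *)
have hj := tau_act_PF_hat p (enum_valP j).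
have hi := tau_act_PF_hat p^-1 (enum_valP i).
rewrite (bigD1 (enum_rank_in hi (tau_act p^-1 (enum_val i)))) //=.
rewrite [RHS](bigD1 (enum_rank_in hj (tau_act p (enum_val j)))) //=.
have pi : tau_act p (tau_act p^-1 (enum_val i)) = enum_val i.
  by rewrite -tau_actM mulgV (tau_act1 (enum_valP i)).
rewrite !enum_rankK_in // eqxx pi eqxx mul1r mulr1.
rewrite !big1 ?addr0 => [|k kN|k kN].
- by rewrite -(Kinv p _ _ hi (enum_valP j)) pi.
- case: eqVneq => [e|_]; last by rewrite mulr0.
  by case/eqP: kN; apply: enum_val_inj; rewrite enum_rankK_in.
case: eqVneq => [e|_]; last by rewrite mul0r.
case/eqP: kN; apply: enum_val_inj; rewrite enum_rankK_in // e.
by rewrite -tau_actM mulVg (tau_act1 (enum_valP k)).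
Qed.

Lemma tau_mx_trace (F : fieldType) c p :
  \tr (@tau_mx m F c p) = #|[set x in PF_hat m c | tau_act p x == x]|%:R.
Proof.
rewrite /mxtrace.
under eq_bigr do rewrite mxE.
rewrite -(big_enum_val (fun x => (x == tau_act p x)%:R)) -natr_sum.
rewrite -big_mkcondr /= sum1dep_card.
by congr (_%:R); apply: eq_card => x; rewrite in_set [RHS]in_set eq_sym.
Qed.

(* Multiplication by a unit of Z_n commutes with shifts and permutations. *)
Lemma tau_rsim_unit (F : fieldType) (c d u : nat) :
  coprime u m.+1 -> (c * u = d %[mod m.+1])%N ->
  mx_rsim (tau_repr F c) (tau_repr F d).
Proof.
move=> co cud.
have [w wu] := coprime_inv_mod co.
have scaleK x : x *+ u *+ w = x.
  apply/ffunP => i; rewrite !ffunMnE -mulrnA -[x i]inZp_val -inZpM.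
  by apply: val_inj; rewrite /= -modnMm wu modnMm muln1.
pose sc k x := pf_norm (x *+ k).
have scN k x : sc k (pf_norm x) = pf_norm (x *+ k).
  rewrite /sc /pf_norm.
  have -> : shift (pf_shift x) x *+ k = shift (pf_shift x *+ k) (x *+ k).
    by apply/ffunP => i; rewrite !(ffunMnE, ffunE) mulrnDl.
  by rewrite -/(pf_norm _) pf_norm_shift.
have scK x : in_PF x -> sc w (sc u x) = x.
  by move=> hx; rewrite {2}/sc scN scaleK pf_norm_id.
have sc_tau p k x : sc k (tau_act p x) = tau_act p (sc k x).
  rewrite tau_actE scN tau_act_norm; congr pf_norm.
  by apply/ffunP => i; rewrite !(ffunMnE, ffunE).
(* The kernel is the graph of the bijection [sc u], inverted by the graph of [sc w], with scalar
   1. *)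
apply: (@tau_rsim_kernel F c d (fun x y => (sc u x == y)%:R)
          (fun y x => (sc w y == x)%:R) 1 (oner_neq0 F)).
  move=> p x y hx /PF_hatP[hy _]; rewrite sc_tau.
  congr (_ %:R); congr (nat_of_bool _); apply/eqP/eqP => [|-> //].
  by apply: tau_act_inj => //; exact: in_PF_norm.
move=> x x' /PF_hatP[hx sx] hx'.
have hy : sc u x \in PF_hat m d.
  apply: pf_norm_PF_hat; under eq_bigr do rewrite ffunMnE.
  by rewrite sumrMnl sx -inZpM; apply: val_inj.
rewrite (bigD1 (sc u x)) //= eqxx scK //= mulr1n !mul1r big1 ?addr0 // => y.
by case/andP => _ /negPf; rewrite eq_sym => ->; rewrite mul0r.
Qed.

End Normalization.

(** * The Gaussian kernel *)

Section Gauss.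
Variables (m : nat) (F : fieldType) (theta : F).
Hypothesis theta_prim : (m.+1.*2).-primitive_root theta.
Hypothesis n_even : ~~ odd m.+1.
Notation Zn := 'I_m.+1.
Notation word := {ffun Zn -> Zn}.
Implicit Types (x y z v : word) (a b t : Zn).

Let omega := theta ^+ 2.

(* [omega] has order n, and [q] is well defined modulo n because n is even. *)
Let q a := theta ^+ (a ^ 2).
(** The pairing of Z_n with itself that polarizes the quadratic function [q]; see [qD]. *)
Let chi a b := omega ^+ (a * b).

Let half_eq : m.+1 = (m.+1)./2.*2.
Proof. by rewrite -[LHS]odd_double_half (negPf n_even). Qed.

Let omega_prim : m.+1.-primitive_root omega.
Proof.
have := dvdn_prim_root theta_prim (m := m.+1).
by rewrite -mul2n mulnK // dvdn_mull //; apply.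
Qed.

Let qE (j : nat) : q (inZp j) = theta ^+ (j ^ 2).
Proof.
rewrite /q; apply/eqP; rewrite (eq_prim_root_expr theta_prim) /=.
set r := (j %% _)%N; pose k := (j %/ m.+1)%N; pose h := (m.+1)./2.
(* Write j = kn + r with n = 2h: then 2knr = kr(2n) and (kn)^2 = k^2 h(2n), both multiples of the
   order 2n of [theta]. *)
have -> : (j ^ 2 = (k * r + k * k * h) * (m.+1).*2 + r ^ 2)%N.
  rewrite (divn_eq j m.+1) -/r -/k; have := half_eq; rewrite -/h; nia.
by rewrite modnMDl.
Qed.

Let chiE (j k : nat) : chi (inZp j) (inZp k) = omega ^+ (j * k).
Proof.
rewrite /chi; apply/eqP; rewrite (eq_prim_root_expr omega_prim) /=.
by rewrite modnMm.
Qed.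

Let qD a b : q (a + b) = q a * q b * chi a b.
Proof.
rewrite -[a]inZp_val -[b]inZp_val -inZpD !qE chiE /omega -exprM -!exprD.
by congr (_ ^+ _); lia.
Qed.

Let chi_inj : injective (chi^~ (inZp 1)).
Proof.
move=> a b; rewrite /= -[a]inZp_val -[b]inZp_val !chiE !muln1.
move/eqP; rewrite (eq_prim_root_expr omega_prim) => /eqP e.
exact: val_inj.
Qed.

Let chiDl a b t : chi (a + b) t = chi a t * chi b t.
Proof.
rewrite -[a]inZp_val -[b]inZp_val -[t]inZp_val -inZpD !chiE -exprD.
by rewrite mulnDl.
Qed.

Let chiC a b : chi a b = chi b a.
Proof. by rewrite /chi mulnC. Qed.

Let theta_neq0 : theta != 0.
Proof.
apply/eqP => t0; have /eqP := prim_expr_order theta_prim.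
by rewrite t0 expr0n eq_sym oner_eq0.
Qed.

Let q_neq0 a : q a != 0. Proof. exact: expf_neq0. Qed.

Let chi_neq0 a b : chi a b != 0. Proof. by do 2!apply: expf_neq0. Qed.

Let chi0l b : chi 0 b = 1. Proof. by rewrite /chi mul0n. Qed.

Let chiNl a b : chi (- a) b = (chi a b)^-1.
Proof.
by apply: (mulfI (chi_neq0 a b)); rewrite -chiDl subrr chi0l divff.
Qed.

Let chi_sum (I : Type) (s : seq I) (f : I -> Zn) t :
  \prod_(i <- s) chi (f i) t = chi (\sum_(i <- s) f i) t.
Proof.
by apply/esym/(big_morph (chi^~ t)) => [a b|]; [exact: chiDl | exact: chi0l].
Qed.

Let theta_half : theta ^+ m.+1 = -1.
Proof.
have : theta ^+ m.+1 != 1.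
  by rewrite -(prim_order_dvd theta_prim) gtnNdvd // -addnn; lia.
have /eqP : (theta ^+ m.+1) ^+ 2 = 1.
  by rewrite -exprM muln2 prim_expr_order.
by rewrite sqrf_eq1 => /orP[->|/eqP].
Qed.

Let G z := \prod_i q (z i).

Let G_neq0 z : G z != 0.
Proof. by apply/prodf_neq0. Qed.

Let GD z v : G (z + v) = G z * G v * \prod_i chi (z i) (v i).
Proof.
rewrite /G -!big_split /=; apply: eq_bigr => i _.
by rewrite ffunE qD.
Qed.

(* The constant t contributes (-1)^(t^2) through q(t)^n and (-1)^t through
   the cross term. *)
Let G_shift t z : \sum_i z i = inZp (m.+1)./2 -> G (shift t z) = G z.
Proof.
move=> sz; have -> : shift t z = z + [ffun=> t].
  by apply/ffunP => i; rewrite !ffunE addrC.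
rewrite GD; under [X in _ * X]eq_bigr do rewrite ffunE.
rewrite chi_sum sz -[RHS]mulr1 -mulrA; congr (_ * _).
rewrite {1}/G; under eq_bigr do rewrite ffunE.
rewrite prodr_const card_ord -[X in chi _ X]inZp_val chiE /q /omega -!exprM.
(* The exponents n t^2 and n t add up to n t(t+1), and t(t+1) is even. *)
rewrite -exprD (_ : _ + _ = m.+1 * (t * t.+1))%N.
  by rewrite exprM theta_half -signr_odd oddM /= andbN.
by rewrite mulnA mul2n -half_eq; lia.
Qed.

Let K x y := G (x - y).

(** Normalizing [x] shifts [x - y] by a constant, so [G_shift] applies. *)
Let K_norml x y :
  \sum_i x i - \sum_i y i = inZp (m.+1)./2 -> K (pf_norm x) y = K x y.
Proof.
move=> s; rewrite /K.
have -> : pf_norm x - y = shift (pf_shift x) (x - y).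
  by apply/ffunP => i; rewrite !ffunE addrA.
rewrite G_shift // -s -sumrB; apply: eq_bigr => i _.
by rewrite !ffunE.
Qed.

Let K_normr x y :
  \sum_i x i - \sum_i y i = inZp (m.+1)./2 -> K x (pf_norm y) = K x y.
Proof.
move=> s; rewrite /K.
have -> : x - pf_norm y = shift (- pf_shift y) (x - y).
  by apply/ffunP => i; rewrite !ffunE opprD addrCA.
rewrite G_shift // -s -sumrB; apply: eq_bigr => i _.
by rewrite !ffunE.
Qed.

Let sum_permute p x : \sum_i permute p x i = \sum_i x i.
Proof.
under eq_bigr do rewrite ffunE.
by rewrite [RHS](reindex_inj (@perm_inj _ p)).
Qed.

Let K_permute p x y : K (permute p x) (permute p y) = K x y.
Proof.
rewrite /K /G [RHS](reindex_inj (@perm_inj _ p)) /=.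
by apply: eq_bigr => i _; rewrite !ffunE.
Qed.

(** Over a general field the transposed pointwise inverse of [K] takes the place of the conjugate
    transpose. Diagonal sums equal the size of [PF_hat m d], nonzero in characteristic 0. *)
Lemma tau_rsim_gauss c d : [pchar F] =i pred0 ->
  inZp c - inZp d = inZp (m.+1)./2 :> Zn ->
  mx_rsim (MxRepresentation (@tau_mx_repr m F c))
          (MxRepresentation (@tau_mx_repr m F d)).
Proof.
move=> F0 cd.
have sxy x y : x \in PF_hat m c -> y \in PF_hat m d ->
    \sum_i x i - \sum_i y i = inZp (m.+1)./2.
  by move=> /PF_hatP[_ ->] /PF_hatP[_ ->].
apply: (@tau_rsim_kernel m F c d K (fun y x => (K x y)^-1)
          #|PF_hat m d|%:R).
- by rewrite pcharf0P in F0; rewrite F0 -lt0n PF_hat_gt0.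
- move=> p x y hx hy.
  rewrite !tau_actE K_norml ?K_normr ?K_permute // ?sum_permute //.
    exact: sxy.
  by rewrite sum_shift sum_permute; exact: sxy.
move=> x x' hx hx'; case: eqVneq => [<-|xx'].
  rewrite mulr1; under eq_bigr => y _ do rewrite mulfV ?G_neq0 //.
  by rewrite sumr_const.
rewrite mulr0; set S := \sum_(y in _) _.
(* Reindexing the sum by y |-> y + v multiplies it by a character value. *)
have S_inv v : \sum_i v i = 0 -> S = S * (\prod_i chi (x i - x' i) (- v i)).
  move=> sv.
  have tv y : y \in PF_hat m d -> translate v y \in PF_hat m d.
    by apply: translate_PF_hat; rewrite sv add0r.
  have tv' y : y \in PF_hat m d -> translate (- v) y \in PF_hat m d.
    apply: translate_PF_hat; under eq_bigr do rewrite ffunE.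
    by rewrite sumrN sv oppr0 add0r.
  rewrite {1}/S (reindex_onto (translate v) (translate (- v))) /=; last first.
    by move=> y /PF_hatP[hy _]; rewrite -{1}[v]opprK translateK.
  rewrite mulr_suml; apply: eq_big => y.
    apply/andP/idP => [[/tv' + /eqP <-]|hy] //.
    by rewrite tv // translateK ?eqxx //; case/PF_hatP: hy.
  case/andP => /tv' + /eqP e; rewrite e => hy.
  have KE z : z \in PF_hat m c -> K z (translate v y) =
      K z y * G (- v) * \prod_i chi (z i - y i) (- v i).
    move=> hz; rewrite K_normr.
      rewrite /K opprD addrA [LHS]GD; congr (_ * _).
      by apply: eq_bigr => i _; rewrite !ffunE.
    under [X in _ - X]eq_bigr do rewrite ffunE.
    by rewrite big_split /= sv addr0; exact: sxy.
  rewrite !KE // !invfM mulrACA; congr (_ * _).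
    by rewrite mulrACA divff ?G_neq0 // mulr1.
  rewrite -prodfV -big_split /=; apply: eq_bigr => i _.
  rewrite -chiNl -chiDl; congr (chi _ _).
  by rewrite opprB addrA subrK.
(* If S were nonzero, every character value in [S_inv] would be 1; this makes [x - x'] constant, so
   the normalized words [x] and [x'] coincide. *)
apply/eqP; case: (eqVneq S 0) => // S0; case/eqP: xx'.
have chi1 j : chi (x j - x' j) (inZp 1) = chi (x ord0 - x' ord0) (inZp 1).
  pose e : Zn := inZp 1.
  (* A word of sum zero supported on positions 0 and j compares [x - x'] at these two positions. *)
  pose v : word := [ffun i => e *+ (i == ord0) - e *+ (i == j)].
  have delta (k : Zn) : \sum_i e *+ (i == k) = e.
    by rewrite (bigD1 k) //= eqxx big1 ?addr0 // => i /negPf ->.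
  have chi_delta k : \prod_i chi (e *+ (i == k)) (x i - x' i) =
      chi (x k - x' k) e.
    rewrite (bigD1 k) //= eqxx big1 ?mulr1 1?chiC // => i /negPf ->.
    exact: chi0l.
  have sv : \sum_i v i = 0.
    by under eq_bigr do rewrite ffunE; rewrite sumrB !delta subrr.
  have /esym := S_inv v sv; rewrite -[RHS]mulr1 => /(mulfI S0).
  under eq_bigr do rewrite ffunE opprB chiC chiDl chiNl.
  rewrite big_split prodfV /= !chi_delta => /divr1_eq.
  exact.
pose t := x ord0 - x' ord0.
have e : x = shift t x'.
  apply/ffunP => j; rewrite ffunE; apply/eqP; rewrite -subr_eq; apply/eqP.
  exact: chi_inj (chi1 j).
have [hx1 _] := PF_hatP hx; have [hx2 _] := PF_hatP hx'.
by rewrite -(pf_norm_id hx1) -(pf_norm_id hx2) e pf_norm_shift.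
Qed.

End Gauss.

(** * Fixed points of rotations *)

Section Rotation.
Variable m : nat.
Notation Zn := 'I_m.+1.
Notation word := {ffun Zn -> Zn}.
Implicit Types (x y z v : word) (a b t : Zn).

Lemma quasiperiodic_iter x t (q j r : nat) :
  (forall i, x (inZp q + i) = x i + t) ->
  x (inZp (j * q + r)) = x (inZp r) + t *+ j.
Proof.
move=> xq; elim: j => [|j IH]; first by rewrite mul0n addr0.
by rewrite mulSn -addnA inZpD xq IH mulrSr addrA.
Qed.

(** Cut Z_n into k blocks of length q: block j exceeds block 0 by q j t, and the j below k sum to
    C(k,2). *)
Lemma sum_quasiperiodic x t (k q : nat) : (k * q = m.+1)%N ->
  (forall i, x (inZp q + i) = x i + t) ->
  \sum_i x i = (\sum_(r < q) x (inZp r)) *+ k + t *+ (q * 'C(k, 2)).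
Proof.
move=> kq xq.
have -> : \sum_i x i = \sum_(0 <= i < k * q) x (inZp i).
  by rewrite kq big_mkord; apply: eq_bigr => i _; rewrite inZp_val.
rewrite -(big_mkord xpredT (fun r => x (inZp r))).
set A := \sum_(0 <= i < q) _.
elim: {kq} k => [|k IH]; first by rewrite big_geq // bin_small // muln0 addr0.
rewrite mulSnr (@big_cat_nat _ _ _ (k * q)) ?leq_addr //= IH.
have -> : \sum_(k * q <= i < k * q + q) x (inZp i) =
          \sum_(0 <= i < q) (x (inZp i) + t *+ k).
  rewrite -{1}[(k * q)%N]add0n big_addn addKn.
  by apply: eq_bigr => i _; rewrite addnC (quasiperiodic_iter _ _ xq).
rewrite big_split /= sumr_const_nat subn0 -mulrnA binS bin1 mulnDr mulrnDr.
by rewrite mulrSr (mulnC k) addrACA.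
Qed.

Definition rotation (q : nat) : 'S_m.+1 := perm (@addrI Zn (inZp q)).

(** A fixed point is q-periodic up to a constant t, which [sum_quasiperiodic] turns into a formula
    for c; the parity condition, equivalent to k dividing N, removes the term in t. *)
Lemma rotation_fix_dvd (c k q : nat) x : (k * q = m.+1)%N ->
  odd k || ~~ odd q -> x \in PF_hat m c -> tau_act (rotation q) x = x ->
  (k %| c)%N.
Proof.
move=> kq par /PF_hatP[_ sx] fx.
set t : Zn := - pf_shift (permute (rotation q) x).
have xq i : x (inZp q + i) = x i + t.
  by rewrite -{2}fx /t /tau_act !ffunE permE addrAC subrr add0r.
(* After k steps of length q the position returns to its start. *)
have kt : t *+ k = 0.
  apply: (@addrI _ (x (inZp 0))); rewrite -(quasiperiodic_iter k 0 xq).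
  rewrite addn0 addr0 kq; congr (x _).
  by apply: val_inj; rewrite /= modnn mod0n.
(* For k odd, k divides C(k,2) already; for q even, q C(k,2) = (q/2) k (k-1). *)
have /dvdnP[s e] : (k %| q * 'C(k, 2))%N.
  case/orP: par => [ok|eq]; first by rewrite bin2odd // mulnCA dvdn_mulr.
  rewrite -[q]odd_double_half (negPf eq) add0n -mul2n mulnAC mul_bin_left.
  by rewrite bin1 mulnAC dvdn_mull.
have := sum_quasiperiodic kq xq; rewrite sx e mulnC mulrnA kt mul0rn addr0.
set A := \sum_(r < q) _; rewrite -[A]inZp_val -inZpM => /(congr1 val) /= ee.
have : (k %| c %% m.+1)%N.
  by rewrite ee dvdn_modr // ?dvdn_mull // -kq dvdn_mulr.
by rewrite dvdn_modr // -kq dvdn_mulr.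
Qed.

Lemma rotation_fix_ex (c k q : nat) : (k * q = m.+1)%N -> (k %| c)%N ->
  exists2 x, x \in PF_hat m c & tau_act (rotation q) x = x.
Proof.
move=> kq kc.
have q0 : (0 < q)%N by case: q kq => //; rewrite muln0.
have qn : (q %| m.+1)%N by rewrite -kq dvdn_mull.
(* The value c/k sits at the k multiples of q, and 0 elsewhere: a q-periodic word of sum c. *)
pose x : word := [ffun i : Zn => inZp (if (q %| i)%N then c %/ k else 0)%N].
have xq i : x (inZp q + i) = x i.
  by rewrite !ffunE /= modnDml dvdn_modr // dvdn_addr.
exists (pf_norm x).
  apply: pf_norm_PF_hat.
  rewrite (@sum_quasiperiodic x 0 k q kq) => [|i]; last by rewrite xq addr0.
  rewrite mul0rn addr0 (bigD1 (Ordinal q0)) //= big1 => [|i].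
    by rewrite ffunE /= mod0n dvdn0 addr0 -inZpM divnK.
  rewrite -val_eqE -lt0n /= => i0; rewrite ffunE /= dvdn_modr // gtnNdvd //.
  by apply: val_inj; rewrite /= mod0n.
rewrite tau_act_norm; congr pf_norm.
by apply/ffunP => i; rewrite ffunE permE xq.
Qed.

(** Traces count fixed points, and in characteristic 0 they detect whether there are any. *)
Lemma tau_rsim_dvd (F : fieldType) c d (k q : nat) : [pchar F] =i pred0 ->
  (k * q = m.+1)%N -> odd k || ~~ odd q ->
  mx_rsim (MxRepresentation (@tau_mx_repr m F c))
          (MxRepresentation (@tau_mx_repr m F d)) ->
  (k %| c)%N -> (k %| d)%N.
Proof.
move=> /pcharf0P F0 kq par rs kc; have [x hx fx] := rotation_fix_ex kq kc.
have /= := mxtrace_rsim rs (in_setT (rotation q)); rewrite !tau_mx_trace.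
case: (set_0Vmem [set x in PF_hat m d | tau_act (rotation q) x == x]).
  move=> ->; rewrite cards0 => /eqP; rewrite F0 cards_eq0.
  by move=> /eqP/setP/(_ x); rewrite in_set hx fx eqxx in_set0.
by case=> y; rewrite in_set => /andP[hy /eqP fy] _; exact: rotation_fix_dvd fy.
Qed.

End Rotation.

(** * Classification *)

Section Classification.
Variables (R : realType) (m : nat).
Let N := half_if_even m.+1.

Let char0 : [pchar R[i]] =i pred0. Proof. exact: pchar_num. Qed.

Lemma tau_rsim_gcd_dvd (c d : nat) :
  mx_rsim (tau R m c) (tau R m d) -> (gcdn c N %| gcdn d N)%N.
Proof.
move=> rs; have := dvdn_gcdr c N; set k := gcdn c N => kN.
rewrite dvdn_gcd kN andbT.
(* Divisibility of N supplies the parity condition: k is odd if n is odd, and n/k is even if n is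
   even. *)
move: kN; rewrite half_if_even_dvd // => /andP[kn par].
apply: (@tau_rsim_dvd m R[i] c d k (m.+1 %/ k) char0 _ _ rs) => //.
- by rewrite mulnC divnK.
- move: par; rewrite !modn2; case: (boolP (odd m.+1)) => [|_]; last first.
    by rewrite eqb0 orbC => ->.
  by rewrite -{1}(divnK kn) oddM => /andP[_ ->].
exact: dvdn_gcdl.
Qed.

Lemma tau_isoE (c d : nat) : tau_iso R m c d = (gcdn c N == gcdn d N).
Proof.
apply/asboolP/eqP => [rs|].
  apply/eqP; rewrite eqn_dvd !tau_rsim_gcd_dvd //; exact: mx_rsim_sym.
have unit_case c' d' : gcdn c' m.+1 = gcdn d' m.+1 ->
    mx_rsim (tau R m c') (tau R m d').
  by case/gcdn_unit_lift => // u; exact: tau_rsim_unit.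
rewrite /N /half_if_even; case: ifPn => [_|n_even]; first exact: unit_case.
have n2 : m.+1 = (m.+1)./2.*2 by rewrite -[LHS]odd_double_half (negPf n_even).
have h0 : (0 < (m.+1)./2)%N by rewrite half_gt0; case: (m) n_even.
(* Either c or c + n/2 has the same gcd with n as d; in the second case the Gaussian kernel first
   joins c to c + n/2. *)
case/(gcdn_half h0); rewrite -n2 => e; first exact: unit_case.
apply: mx_rsim_trans (unit_case _ _ e).
have [||theta theta_prim] := @prim_root_exists R[i] (m.+1).*2.
- by rewrite double_gt0.
- by rewrite pnatr_eq0 double_eq0.
apply/mx_rsim_sym/(tau_rsim_gauss theta_prim n_even char0).
by rewrite inZpD addrAC subrr add0r.
Qed.

End Classification.

Theorem corollary4p5 (R : realType) (m : nat) :
  #|tau_classes R m| = size (D m.+1).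
Proof.
rewrite size_D //; set N := half_if_even m.+1.
have N0 : (0 < N)%N by exact: half_if_even_gt0.
have Nn : (N <= m.+1)%N by rewrite /N /half_if_even; case: ifP => // _; lia.
(* The isomorphism classes are the fibres of c |-> gcd(c, N), one for each divisor of N. *)
pose block k := [set i : 'I_m.+1 | gcdn i.+1 N == k].
have blockE i : [set j in [set: 'I_m.+1] | tau_iso R m i.+1 j.+1] =
    block (gcdn i.+1 N).
  by apply/setP => j; rewrite !inE tau_isoE eq_sym.
(* The divisor k itself serves as c, since k <= N <= n; its 0-based index is k - 1. *)
have rep k : (k %| N)%N -> exists i : 'I_m.+1, gcdn i.+1 N = k.
  move=> kN; have k0 : (0 < k)%N := dvdn_gt0 N0 kN.
  have km : (k.-1 < m.+1)%N by rewrite prednK // (leq_trans (dvdn_leq _ kN)).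
  by exists (Ordinal km); rewrite /= prednK //; apply/gcdn_idPl.
rewrite -(size_map block) -(card_uniqP _); last first.
  rewrite map_inj_in_uniq ?divisors_uniq // => k l.
  rewrite -!dvdn_divisors // => /rep[i ik] _ /setP/(_ i).
  by rewrite !inE ik eqxx => /esym/eqP.
apply: eq_card => X; apply/imsetP/mapP => [[i _ ->]|[k]].
  by exists (gcdn i.+1 N); rewrite ?blockE // -dvdn_divisors // dvdn_gcdr.
rewrite -dvdn_divisors // => /rep[i <-] ->.
by exists i; rewrite ?blockE.
Qed.
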